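(* Let $v_0,\ldots,v_{m-1}$ be unit vectors in a Euclidean space, let $z_i=\sum_{j=0}^{m-1}d_{ij}v_j$ ($i$ in a finite index set $I$, $d_{ij}\in\mathbb{R}$) be vectors (''residuals'') carrying vertex labels $\ell(i)\in\{0,\ldots,m-1\}$, and suppose $$\langle z_i,v_{\ell(i)}-v_j\rangle\geq 0,\qquad \langle z_i,v_{\ell(i)}\rangle\geq 0$$ for all $i\in I$ and all $0\le j<m$. Let $\mathrm{last}\in I$ be a distinguished index and suppose $z_{\mathrm{last}}=0$, $D_i:=\sum_jd_{ij}\geq C>0$ for all $i\in I$, and $D_{\mathrm{last}}=C$. Choose $s\in(0,1)$ and a unit vector $e$ orthogonal to all $v_j$. Put $a=\sqrt{1-s^2}$ and $$v_j'=av_j+se\quad(0\leq j<m),\qquad v_m'=-e.$$ For $\theta=sC$, define $$z_i'=az_i+(sD_i-\theta)e\qquad(i\in I).$$ Then every $z_i'$ satisfies the projection inequalities against $0,v_0',\ldots,v_m'$, that is, $$\langle z_i',v_{\ell(i)}'-v_j'\rangle\geq 0\quad(0\le j\le m),\qquad \langle z_i',v_{\ell(i)}'\rangle\geq 0$$ for every $i\in I$. If $i=\mathrm{last}$, then $z_i'=0$.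
   Context: All vectors live in a common finite-dimensional Euclidean space with inner product $\langle\cdot,\cdot\rangle$. *)

(* Defs.v *)
From mathcomp Require Import all_boot all_order all_algebra.
From mathcomp Require Import reals.

Set Implicit Arguments.
Unset Strict Implicit.
Unset Printing Implicit Defensive.

Import Order.TTheory GRing.Theory Num.Theory.
Local Open Scope ring_scope.

(* A Euclidean space is a finite-dimensional vector space [V : vectType R] over
   a real number type, with a positive definite symmetric bilinear form
   [dot : {dot V for idfun}]. *)

Definition eucl_norm (R : realType) (V : vectType R) (dot : {dot V for idfun})
    (u : V) : R :=
  Num.sqrt (dot u u).

Definition unit_vector (R : realType) (V : vectType R)
    (dot : {dot V for idfun}) (u : V) : Prop :=
  eucl_norm dot u = 1.

(* The projection inequalities for [x], labelled [l], against the points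
   0, w_0, ..., w_(k-1). *)
Definition projection_inequalities (R : realType) (V : vectType R)
    (dot : {dot V for idfun}) (k : nat) (w : 'I_k -> V) (l : 'I_k) (x : V) :
    Prop :=
  (forall j : 'I_k, 0 <= dot x (w l - w j)) /\ 0 <= dot x (w l).

Definition residual (R : realType) (V : vectType R) (m : nat) (v : 'I_m -> V)
    (I : finType) (d : I -> 'I_m -> R) (i : I) : V :=
  \sum_(j < m) d i j *: v j.

Definition coefficient_sum (R : realType) (m : nat) (I : finType)
    (d : I -> 'I_m -> R) (i : I) : R :=
  \sum_(j < m) d i j.

(* [old_index j] is j itself, seen in {0, ..., m}. *)
Definition old_index (m : nat) (j : 'I_m) : 'I_m.+1 := widen_ord (leqnSn m) j.

(* The family v'_0, ..., v'_m; [unlift ord_max j] is [None] when j = m, and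
   otherwise [Some k] where k has the same value as j. *)
Definition lifted_vertex (R : realType) (V : vectType R) (m : nat)
    (v : 'I_m -> V) (a s : R) (e : V) (j : 'I_m.+1) : V :=
  if unlift ord_max j is Some k then a *: v k + s *: e else - e.

Definition lifted_residual (R : realType) (V : vectType R) (m : nat)
    (v : 'I_m -> V) (I : finType) (d : I -> 'I_m -> R) (a s theta : R) (e : V)
    (i : I) : V :=
  a *: residual v d i + (s * coefficient_sum d i - theta) *: e.

Lemma lifted_vertex_old (R : realType) (V : vectType R) (m : nat)
    (v : 'I_m -> V) (a s : R) (e : V) (j : 'I_m) :
  lifted_vertex v a s e (old_index j) = a *: v j + s *: e.
Proof.
rewrite /lifted_vertex.
have -> : old_index j = lift ord_max j by apply: ord_inj; rewrite lift_max.
by rewrite liftK.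
Qed.

Lemma lifted_vertex_new (R : realType) (V : vectType R) (m : nat)
    (v : 'I_m -> V) (a s : R) (e : V) :
  lifted_vertex v a s e ord_max = - e.
Proof. by rewrite /lifted_vertex unlift_none. Qed.

(* Main.v *)
Require Import Defs.
From mathcomp Require Import all_boot all_order all_algebra.
From mathcomp Require Import reals.
From mathcomp Require Import ring.

Import Order.TTheory GRing.Theory Num.Theory.
Local Open Scope ring_scope.

(** The span of the [v j] is orthogonal to the unit vector [e], so inner
    products split: for [x] and [w] orthogonal to [e],
    <a x + t e, b w + u e> = a b <x, w> + t u ([dot_orthogonal_sum]).

    The residual z'_i has [e]-coordinate t = s (D_i - C), which is nonnegative
    because D_i is at least C.  All the old lifted vertices a v_j + s e share
    the [e]-coordinate s, which cancels in their differences; hence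
      <z'_i, v'_l - v'_j> = a^2 <z_i, v_l - v_j>,
      <z'_i, v'_l>        = a^2 <z_i, v_l> + t s,
      <z'_i, v'_l - v'_m> = <z'_i, v'_l> + t,
    and each right-hand side is a sum of nonnegative terms.  The shift s C is
    the one for which t vanishes where D_i = C; at the last index the part
    a z_i is 0 as well, so z' is 0 there. *)

Lemma unit_vector_dot (R : realType) (V : vectType R) (dot : {dot V for idfun})
    (u : V) :
  unit_vector dot u -> dot u u = 1.
Proof.
rewrite /unit_vector /eucl_norm => sqrt1.
(* The square root is 0 on negative numbers, so the value 1 forces [dot u u]
   to be nonnegative. *)
have uu_ge0 : 0 <= dot u u by rewrite ltW // -sqrtr_gt0 sqrt1.
by rewrite -(sqr_sqrtr uu_ge0) sqrt1 expr1n.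
Qed.

Lemma dot_orthogonal_sum (R : realType) (V : vectType R)
    (dot : {dot V for idfun}) (e x w : V) (a t b u : R) :
  dot e e = 1 -> dot e x = 0 -> dot e w = 0 ->
  dot (a *: x + t *: e) (b *: w + u *: e) = a * b * dot x w + t * u.
Proof.
move=> ee ex ew.
have xe : dot x e = 0 by rewrite hermC /= ex mulr0.
rewrite linearDl /= !linearDr /= !linearZl_LR /= !linearZr_LR /= ee xe ew.
by ring.
Qed.

Lemma dot_residual_eq0 (R : realType) (V : vectType R)
    (dot : {dot V for idfun}) (m : nat) (v : 'I_m -> V) (I : finType)
    (d : I -> 'I_m -> R) (e : V) (i : I) :
  (forall j, dot e (v j) = 0) -> dot e (residual v d i) = 0.
Proof.
move=> e_orth; rewrite /residual linear_sumr big1 // => j _.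
by rewrite linearZr_LR /= e_orth mulr0.
Qed.

Theorem lemma6p1 (R : realType) (V : vectType R) (dot : {dot V for idfun})
    (m : nat) (v : 'I_m -> V)
    (v_unit : forall j : 'I_m, unit_vector dot (v j))
    (I : finType) (d : I -> 'I_m -> R) (l : I -> 'I_m)
    (z_proj : forall i : I,
       projection_inequalities dot v (l i) (residual v d i))
    (ilast : I) (z_last : residual v d ilast = 0)
    (C : R) (C_gt0 : 0 < C)
    (D_ge : forall i : I, C <= coefficient_sum d i)
    (D_last : coefficient_sum d ilast = C)
    (s : R) (s_gt0 : 0 < s) (s_lt1 : s < 1)
    (e : V) (e_unit : unit_vector dot e)
    (e_orth : forall j : 'I_m, dot e (v j) = 0) :
  let a := Num.sqrt (1 - s ^+ 2) in
  let theta := s * C in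
  let v' := lifted_vertex v a s e in
  let z' := lifted_residual v d a s theta e in
  (forall i : I, projection_inequalities dot v' (old_index (l i)) (z' i)) /\
  (forall i : I, i = ilast -> z' i = 0).
Proof.
move=> a theta v' z'.
have ee := unit_vector_dot _ _ _ _ e_unit.
pose t i := s * coefficient_sum d i - theta.
have t_ge0 i : 0 <= t i by rewrite subr_ge0 ler_pM2l.
have dot_z' i b w u : dot e w = 0 ->
    dot (z' i) (b *: w + u *: e) = a * b * dot (residual v d i) w + t i * u.
  by move=> ew; apply: dot_orthogonal_sum => //; apply: dot_residual_eq0.
split=> [i | i ->]; last first.
  by rewrite /z' /lifted_residual z_last D_last subrr scaler0 scale0r addr0.
have [z_diff z_vertex] := z_proj i.
have z'_vertex : 0 <= dot (z' i) (v' (old_index (l i))).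
  rewrite /v' lifted_vertex_old dot_z' //.
  by rewrite addr_ge0 ?mulr_ge0 ?sqrtr_ge0 // ltW.
split=> // j; case: (unliftP ord_max j) => [k | ] ->.
  have -> : lift ord_max k = old_index k by apply: ord_inj; rewrite lift_max.
  rewrite /v' !lifted_vertex_old opprD addrACA subrr addr0 -scalerBr.
  have := dot_z' i a (v (l i) - v k) 0.
  rewrite scale0r addr0 mulr0 addr0 => -> //.
    by rewrite !mulr_ge0 ?sqrtr_ge0.
  by rewrite linearBr /= !e_orth subrr.
have z'_e : dot (z' i) e = t i.
  (* [e] itself is the combination with [e]-coordinate 1 and zero part in the
     orthogonal complement. *)
  have := dot_z' i 0 0 1.
  by rewrite scaler0 add0r scale1r mulr0 mul0r add0r mulr1 => -> //;
    rewrite linear0r.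
rewrite {2}/v' lifted_vertex_new opprK linearDr /= z'_e.
exact: addr_ge0.
Qed.
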